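(* With the setting and notation of the context, assume that $\widetilde X_m$ is a sufficiently accurate approximation to $X_m$ in the sense that $$\delta_m:=3|\lambda_n-\tau|\,\|\sin\Phi_m\|^2<|\lambda_{m+1}-\tau|.$$ Let $r_{\mathrm{in},j}$ be the residual of the $j$th MINRES iterate, $j=1,2,\dots,n-m$, for the correction equation $$(I-\widetilde X_m\widetilde X_m^* )(A-\tau I)(I-\widetilde X_m\widetilde X_m^* )t=-r_1\quad\text{with } t\perp\widetilde X_m .$$ (i) If $\tau>\dfrac{\lambda_{\max}+\lambda_{\max,m+1}}{2}$, where $\lambda_{\max}$ and $\lambda_{\max,m+1}$ are respectively the 1st and $(m+1)$th largest eigenvalues of $A$, then $$\frac{\|r_{\mathrm{in},j}\|}{\|r_1\|}\le 2\left(1-\frac{2}{1+\sqrt{(\tau-\lambda_{\min}+\delta_m)/(\tau-\lambda_{\max,m+1}-\delta_m)}}\right)^{j}.$$ (ii) If $\tau<\dfrac{\lambda_{\min}+\lambda_{\min,m+1}}{2}$, where $\lambda_{\min}$ and $\lambda_{\min,m+1}$ are respectively the 1st and $(m+1)$th smallest eigenvalues of $A$, then $$\frac{\|r_{\mathrm{in},j}\|}{\|r_1\|}\le 2\left(1-\frac{2}{1+\sqrt{(\lambda_{\max}-\tau+\delta_m)/(\lambda_{\min,m+1}-\tau-\delta_m)}}\right)^{j}.$$ (iii) If $\dfrac{\lambda_{\min}+\lambda_{\min,m+1}}{2}<\tau<\dfrac{\lambda_{\max}+\lambda_{\max,m+1}}{2}$, then $$\frac{\|r_{\mathrm{in},j}\|}{\|r_1\|}\le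 2\left(1-\frac{2}{1+(|\lambda_n-\tau|+\delta_m)/(|\lambda_{m+1}-\tau|-\delta_m)}\right)^{[j/2]},$$ where $\lambda_n$ is the eigenvalue further from the target $\tau$ between $\lambda_{\max}$ and $\lambda_{\min}$, and $[j/2]$ is the integer part of $j/2$.
   Context: $\|\cdot\|$ is the vector 2-norm and the induced (spectral) matrix norm; $^*$ is the conjugate transpose; $t\perp\widetilde X_m$ means $\widetilde X_m^*t=0$. $A\in\mathbb{C}^{n\times n}$ is Hermitian, with eigendecomposition $A=X\Lambda X^*$, where $X=[x_1,\dots,x_n]$ is unitary and $\Lambda=\operatorname{diag}\{\lambda_1,\dots,\lambda_n\}$ is real. $\tau\in\mathbb{R}$ is a given target and $1\le m<n$. The eigenvalues are ordered so that $$|\lambda_1-\tau|\le\dots\le|\lambda_m-\tau|<|\lambda_{m+1}-\tau|\le\dots\le|\lambda_n-\tau|.$$ $\lambda_{\max}$ and $\lambda_{\min}$ are the largest and smallest eigenvalues of $A$; the $i$th largest and $i$th smallest eigenvalues are counted with multiplicity. Put $X_m=[x_1,\dots,x_m]$. Ritz pairs: let $\mathcal{X}\subset\mathbb{C}^n$ be a $k$-dimensional subspace, $k\ge m$, and let the columns of $\widetilde X\in\mathbb{C}^{n\times k}$ form an orthonormal basis of $\mathcal{X}$. Let $(\theta_i,s_i)$, $i=1,\dots,k$, be the eigenpairs of $H=\widetilde X^*A\widetilde X$, with $s_1,\dots,s_k$ orthonormal and ordered so that $|\theta_1-\tau|\le\dots\le|\theta_k-\tau|$. The Ritz pairs are $(\theta_i,\tilde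 x_i)=(\theta_i,\widetilde Xs_i)$. Put $\widetilde X_m=[\tilde x_1,\dots,\tilde x_m]$, which has orthonormal columns, and $r_1=A\tilde x_1-\theta_1\tilde x_1$ (so $r_1\perp\mathcal{X}$), with $r_1\ne0$ (i.e. $(\theta_1,\tilde x_1)$ has not converged). $\Phi_m$ is the diagonal matrix of canonical (principal) angles between the ranges of $\widetilde X_m$ and $X_m$; thus $\|\sin\Phi_m\|=\|\widetilde Y_m^*X_m\|$ for any matrix $\widetilde Y_m$ whose columns form an orthonormal basis of the orthogonal complement of the range of $\widetilde X_m$. MINRES: let $\widetilde B_m=(I-\widetilde X_m\widetilde X_m^* )(A-\tau I)(I-\widetilde X_m\widetilde X_m^* )$. The starting vector is $\tilde t_0=0$. In exact arithmetic, the $j$th MINRES iterate $\tilde t_j$ is the minimizer of $\|\widetilde B_m t+r_1\|$ over $t$ in the Krylov subspace $\operatorname{span}\{r_1,\widetilde B_m r_1,\dots,\widetilde B_m^{\,j-1}r_1\}$ (contained in the orthogonal complement of the range of $\widetilde X_m$), and the inner residual is $r_{\mathrm{in},j}=\widetilde B_m\tilde t_j+r_1$. *)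

(* Defs.v *)
From HB Require Import structures.
From mathcomp Require Import all_boot all_order all_algebra.
From mathcomp Require Import sesquilinear spectral complex.
From mathcomp Require Import all_classical all_reals all_analysis.

Set Implicit Arguments.
Unset Strict Implicit.
Unset Printing Implicit Defensive.

Import Order.TTheory GRing.Theory Num.Theory.

Local Open Scope ring_scope.
Local Open Scope sesquilinear_scope.
Local Open Scope complex_scope.
Local Open Scope classical_set_scope.

Section Norms.
Variable R : realType.

Definition vnorm n (v : 'cV[R[i]]_n) : R :=
  Num.sqrt (\sum_i Normc.normc (v i 0) ^+ 2).

Definition opnorm m n (M : 'M[R[i]]_(m, n)) : R :=
  sup [set vnorm (M *m v) | v in [set v : 'cV[R[i]]_n | vnorm v = 1]].

Definition diagC n (d : 'rV[R]_n) : 'M[R[i]]_n :=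
  diag_mx (map_mx (real_complex R) d).

(* Meant for U and V with orthonormal columns: the cosines of the canonical
   angles between their ranges are the singular values of U^* V.  The angles
   are listed in no particular order. *)
Definition canonical_angles n m (U V : 'M[R[i]]_(n, m)) (phi : 'rV[R]_m) :=
  (forall i, 0 <= phi 0 i <= pi / 2) /\
  exists P Q : 'M[R[i]]_m,
    [/\ P \is unitarymx, Q \is unitarymx &
        U^t* *m V = P *m diagC (map_mx cos phi) *m Q^t*].

Definition krylov n (B : 'M[R[i]]_n) (r : 'cV[R[i]]_n) (j : nat)
    (t : 'cV[R[i]]_n) :=
  exists c : 'I_j -> R[i], t = \sum_(i < j) c i *: (B ^+ i *m r).

(* t is the j-th MINRES iterate, started at 0, for the system B t = - r. *)
Definition minres_iterate n (B : 'M[R[i]]_n) (r : 'cV[R[i]]_n) (j : nat)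
    (t : 'cV[R[i]]_n) :=
  krylov B r j t /\
  forall u, krylov B r j u -> vnorm (B *m t + r) <= vnorm (B *m u + r).

Definition first_cols n m k (hmk : (m <= k)%N) (M : 'M[R[i]]_(n, k)) :
  'M[R[i]]_(n, m) := colsub (widen_ord hmk) M.

End Norms.

(* The i-th largest and i-th smallest entries of s, counted with multiplicity;
   i starts at 1. *)
Definition ith_largest (R : realType) (s : seq R) (i : nat) : R :=
  (sort (fun a b => b <= a) s)`_i.-1.

Definition ith_smallest (R : realType) (s : seq R) (i : nat) : R :=
  (sort (fun a b => a <= b) s)`_i.-1.

(* Main.v *)
Require Import Defs.
From HB Require Import structures.
From mathcomp Require Import all_boot all_order all_algebra.
From mathcomp Require Import sesquilinear spectral complex.
From mathcomp Require Import all_classical all_reals all_analysis.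
From mathcomp Require Import ring lra.

Set Implicit Arguments.
Unset Strict Implicit.
Unset Printing Implicit Defensive.

Import Order.TTheory GRing.Theory Num.Theory.

Local Open Scope ring_scope.
Local Open Scope sesquilinear_scope.
Local Open Scope complex_scope.

(* In the eigenbasis of A the shifted matrix is diag(mu), and F, E are the
   projectors onto the ranges of Xt_m and X_m; the angles give
   ||(1 - E) F|| <= s and ||E (1 - F)|| <= s with s = ||sin Phi_m||.  The
   eigenvalues beta of the operator restricted to ker F are located without any
   eigenvalue perturbation theorem.  If mu has a constant sign on ker E, then
   beta = <v, diag(mu) v> / <v, v>, and the component E v has size at most
   s ||v||.  In the indefinite case the eigenvector equation is tested against
   sgn(diag(mu)) (1 - E) v.  The MINRES residual is at most max |p(beta)| times
   ||r_1|| for every polynomial p of degree at most j with p(0) = 1; p is a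
   Chebyshev polynomial for an interval, composed with x^2 in the indefinite
   case. *)

(** * Vector norm and operator bounds *)

Section VectorNorm.
Variable R : realType.
Local Notation C := R[i].

Definition dot n (u v : 'cV[C]_n) : C := (u^t* *m v) 0 0.

Lemma dotE n (u v : 'cV[C]_n) : dot u v = \sum_i ((u i 0)^*)%R * v i 0.
Proof. by rewrite /dot mxE; apply: eq_bigr => i _; rewrite !mxE. Qed.

Lemma normCE (x : C) : `|x| = (Normc.normc x)%:C.
Proof. by []. Qed.

Lemma normc_sqrE (x : C) : (Normc.normc x ^+ 2)%:C = (x^*)%R * x.
Proof. by rewrite rmorphXn /= -normCE normCKC. Qed.

Lemma normc_ge0 (x : C) : 0 <= Normc.normc x.
Proof. by rewrite -lecR -normCE normr_ge0. Qed.

Lemma normc_real (x : R) : Normc.normc x%:C = `|x|.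
Proof. by rewrite /= expr0n addr0 sqrtr_sqr. Qed.

Lemma normcD_le (x y : C) :
  Normc.normc (x + y) <= Normc.normc x + Normc.normc y.
Proof. by rewrite -lecR rmorphD /= -!normCE ler_normD. Qed.

Lemma vnorm_ge0 n (v : 'cV[C]_n) : 0 <= vnorm v.
Proof. exact: sqrtr_ge0. Qed.

Lemma vnorm_sqr n (v : 'cV[C]_n) :
  vnorm v ^+ 2 = \sum_i Normc.normc (v i 0) ^+ 2.
Proof. by rewrite sqr_sqrtr// sumr_ge0// => i _; rewrite sqr_ge0. Qed.

Lemma dotvv n (v : 'cV[C]_n) : dot v v = (vnorm v ^+ 2)%:C.
Proof.
rewrite vnorm_sqr dotE rmorph_sum /=; apply: eq_bigr => i _.
by rewrite normc_sqrE.
Qed.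

Lemma vnorm_eq0 n (v : 'cV[C]_n) : (vnorm v == 0) = (v == 0).
Proof.
apply/eqP/eqP => [v0|->]; last first.
  by rewrite /vnorm big1 ?sqrtr0// => i _; rewrite mxE Normc.normc0 expr0n.
have /eqP : vnorm v ^+ 2 = 0 by rewrite v0 expr0n.
rewrite vnorm_sqr psumr_eq0 => [/allP vi0|i _]; last exact: sqr_ge0.
apply/colP => i; rewrite mxE; apply: Normc.eq0_normc; apply/eqP.
by rewrite -sqrf_eq0; apply: (implyP (vi0 i (mem_index_enum i))).
Qed.

Lemma vnorm_gt0 n (v : 'cV[C]_n) : (0 < vnorm v) = (v != 0).
Proof. by rewrite lt_def vnorm_eq0 vnorm_ge0 andbT. Qed.

Lemma le_vnorm n (u v : 'cV[C]_n) :
  (forall i, Normc.normc (u i 0) <= Normc.normc (v i 0)) -> vnorm u <= vnorm v.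
Proof.
move=> le_uv; rewrite ler_wsqrtr// ler_sum// => i _.
by rewrite lerXn2r ?nnegrE ?normc_ge0.
Qed.

Lemma vnormZ n (a : C) (v : 'cV[C]_n) : vnorm (a *: v) = Normc.normc a * vnorm v.
Proof.
rewrite -[in RHS](ger0_norm (normc_ge0 a)) -sqrtr_sqr -sqrtrM ?sqr_ge0//.
rewrite mulr_sumr; congr Num.sqrt; apply: eq_bigr => i _.
by rewrite mxE Normc.normcM exprMn.
Qed.

Lemma dot_cauchy_schwarz n (u v : 'cV[C]_n) :
  Normc.normc (dot u v) <= vnorm u * vnorm v.
Proof.
have dotmx_dot (x y : 'cV[C]_n) : dotmx (x^t*) (y^t*) = dot x y.
  by rewrite dotmxE trmxCK.
rewrite -ler_sqr ?nnegrE ?mulr_ge0 ?normc_ge0 ?vnorm_ge0//.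
rewrite -lecR rmorphXn /= -normCE exprMn [leRHS]rmorphM /= -!dotvv.
have [+ _] := CauchySchwarz (@dotmx C n) (u^t*) (v^t*).
by rewrite -!dotmx_dot.
Qed.

Lemma dot_adj m n (K : 'M[C]_(m, n)) (u : 'cV[C]_m) (v : 'cV[C]_n) :
  dot u (K *m v) = dot (K^t* *m u) v.
Proof. by rewrite /dot trmx_mul map_mxM trmxCK mulmxA. Qed.

Lemma vnorm_isom m n (U : 'M[C]_(m, n)) (v : 'cV[C]_n) :
  U^t* *m U = 1%:M -> vnorm (U *m v) = vnorm v.
Proof.
move=> UU; apply/eqP; rewrite -(@eqrXn2 _ 2) ?vnorm_ge0//; apply/eqP/complexI.
by rewrite -!dotvv dot_adj mulmxA UU mul1mx.
Qed.

(** An operator-norm bound stated pointwise, so that it can be used without first showing that a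
    supremum is finite. *)
Definition opbound m n (K : 'M[C]_(m, n)) (s : R) :=
  forall u, vnorm (K *m u) <= s * vnorm u.

(** With K' the adjoint, ||K' u||^2 = <u, K K' u> <= ||u|| s ||K' u|| by Cauchy-Schwarz; cancel one
    factor ||K' u||. *)
Lemma opbound_adj m n (K : 'M[C]_(m, n)) s : 0 <= s -> opbound K s -> opbound (K^t*) s.
Proof.
move=> s0 Ks u; have [->|] := eqVneq (vnorm (K^t* *m u)) 0.
  by rewrite mulr_ge0 ?vnorm_ge0.
rewrite vnorm_eq0 -vnorm_gt0 => Ku0; rewrite -(ler_pM2r Ku0) -expr2.
have -> : vnorm (K^t* *m u) ^+ 2 = Normc.normc (dot u (K *m (K^t* *m u))).
  by rewrite dot_adj dotvv normc_real ger0_norm ?sqr_ge0.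
rewrite (le_trans (dot_cauchy_schwarz _ _))// mulrC mulrAC ler_wpM2r ?vnorm_ge0//.
Qed.

Lemma opbound_isom_adj m n (U : 'M[C]_(m, n)) :
  U^t* *m U = 1%:M -> opbound (U^t*) 1.
Proof. by move=> UU; apply: opbound_adj => // u; rewrite vnorm_isom ?mul1r. Qed.

End VectorNorm.

(** * Adjoints, orthogonal projectors, real diagonal matrices and canonical angles *)

Section Adjoint.
Variable R : realType.
Local Notation C := R[i].

Lemma dotDr n (u v w : 'cV[C]_n) : dot u (v + w) = dot u v + dot u w.
Proof. by rewrite /dot mulmxDr mxE. Qed.

Lemma dotDl n (u v w : 'cV[C]_n) : dot (u + v) w = dot u w + dot v w.
Proof. by rewrite /dot linearD /= map_mxD mulmxDl mxE. Qed.

Lemma dotZr n (a : C) (u v : 'cV[C]_n) : dot u (a *: v) = a * dot u v.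
Proof. by rewrite /dot -scalemxAr mxE. Qed.

Lemma adjM m n p (K : 'M[C]_(m, n)) (L : 'M[C]_(n, p)) :
  (K *m L)^t* = L^t* *m K^t*.
Proof. by rewrite trmx_mul map_mxM. Qed.

Lemma adj1B n (K : 'M[C]_n) : (1%:M - K)^t* = 1%:M - K^t*.
Proof. by rewrite linearB /= map_mxB trmx1 map_mx1. Qed.

Lemma adj_diagC n (d : 'rV[R]_n) : (diagC d)^t* = diagC d.
Proof.
rewrite /diagC tr_diag_mx map_diag_mx; congr diag_mx.
by apply/rowP => i; rewrite !mxE; apply: conjc_real.
Qed.

Lemma diagC_mul n (d : 'rV[R]_n) (v : 'cV[C]_n) i :
  (diagC d *m v) i 0 = (d 0 i)%:C * v i 0.
Proof. by rewrite mul_diag_mx !mxE. Qed.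

Lemma vnorm_diagC_sqr n (d : 'rV[R]_n) (v : 'cV[C]_n) :
  vnorm (diagC d *m v) ^+ 2 = \sum_i d 0 i ^+ 2 * Normc.normc (v i 0) ^+ 2.
Proof.
rewrite vnorm_sqr; apply: eq_bigr => i _.
by rewrite diagC_mul Normc.normcM normc_real exprMn real_normK ?num_real.
Qed.

Lemma opbound_diagC n (d : 'rV[R]_n) s :
  0 <= s -> (forall i, `|d 0 i| <= s) -> opbound (diagC d) s.
Proof.
move=> s0 ds u; rewrite -ler_sqr ?nnegrE ?mulr_ge0 ?vnorm_ge0//.
rewrite vnorm_diagC_sqr exprMn vnorm_sqr mulr_sumr ler_sum// => i _.
by rewrite ler_wpM2r ?sqr_ge0// -[d 0 i ^+ 2]real_normK ?num_real// lerXn2r ?nnegrE.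
Qed.

Lemma projector_compl_idem n (K : 'M[C]_n) :
  K *m K = K -> (1%:M - K) *m (1%:M - K) = 1%:M - K.
Proof. by move=> KK; rewrite mulmxBl mul1mx mulmxBr mulmx1 KK subrr subr0. Qed.

Lemma dot_selfadj n (K : 'M[C]_n) (u v : 'cV[C]_n) :
  K^t* = K -> dot u (K *m v) = dot (K *m u) v.
Proof. by move=> Kadj; rewrite dot_adj Kadj. Qed.

Lemma projector_pythagoras n (K : 'M[C]_n) (u : 'cV[C]_n) :
  K^t* = K -> K *m K = K ->
  vnorm u ^+ 2 = vnorm (K *m u) ^+ 2 + vnorm ((1%:M - K) *m u) ^+ 2.
Proof.
move=> Kadj KK; apply: complexI; rewrite rmorphD /= -!dotvv !dot_adj adj1B Kadj.
by rewrite !mulmxA KK (projector_compl_idem KK) -dotDl -mulmxDl subrKC mul1mx.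
Qed.

Lemma projector_contract n (K : 'M[C]_n) (u : 'cV[C]_n) :
  K^t* = K -> K *m K = K -> vnorm (K *m u) <= vnorm u.
Proof.
move=> Kadj KK; rewrite -ler_sqr ?nnegrE ?vnorm_ge0//.
by rewrite [leRHS](projector_pythagoras u Kadj KK) lerDl sqr_ge0.
Qed.

Lemma isom_projector_adj m n (V : 'M[C]_(n, m)) : (V *m V^t*)^t* = V *m V^t*.
Proof. by rewrite adjM trmxCK. Qed.

Lemma isom_projector_idem m n (V : 'M[C]_(n, m)) :
  V^t* *m V = 1%:M -> V *m V^t* *m (V *m V^t*) = V *m V^t*.
Proof. by move=> VV; rewrite mulmxA -(mulmxA V) VV mulmx1. Qed.

(** The constant [c] only certifies that the supremum is taken over a bounded set; homogeneity then
    reduces [u] to a unit vector. *)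
Lemma opnorm_opbound m n (K : 'M[C]_(m, n)) c :
  opbound K c -> opbound K (opnorm K).
Proof.
move=> Kc u; have [->|u0] := eqVneq u 0.
  have z p : vnorm (0 : 'cV[C]_p) = 0 by apply/eqP; rewrite vnorm_eq0.
  by rewrite mulmx0 !z mulr0.
have nu0 : 0 < vnorm u by rewrite vnorm_gt0.
pose w := ((vnorm u)^-1)%:C *: u.
have nZ p (x : 'cV[C]_p) : vnorm (((vnorm u)^-1)%:C *: x) = (vnorm u)^-1 * vnorm x.
  by rewrite vnormZ normc_real ger0_norm// invr_ge0 ltW.
have w1 : vnorm w = 1 by rewrite nZ mulVf// gt_eqF.
rewrite -ler_pdivrMr// mulrC -nZ scalemxAr; apply: ub_le_sup; last by exists w.
by exists c => _ [x /= x1 <-]; rewrite -[leRHS]mulr1 -x1.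
Qed.

Lemma opnorm_ge0 m n (K : 'M[C]_(m, n)) c : opbound K c -> 0 <= opnorm K.
Proof.
move=> Kc; rewrite /opnorm; set E := (X in sup X).
(* If there is no unit vector, [sup] takes its value 0 on the empty set. *)
have [->|/set0P[x Ex]] := eqVneq E set0; first by rewrite sup0.
have x0 : 0 <= x by case: Ex => v _ <-; apply: vnorm_ge0.
apply: (le_trans x0); apply: ub_le_sup => //.
by exists c => _ [v /= v1 <-]; rewrite -[leRHS]mulr1 -v1.
Qed.

Lemma canonical_angles_sym n m (U V : 'M[C]_(n, m)) phi :
  canonical_angles U V phi -> canonical_angles V U phi.
Proof.
move=> [phi_range [P [Q [P1 Q1 UV]]]]; split=> //; exists Q, P; split=> //.
rewrite -[LHS]trmxCK adjM trmxCK UV !adjM trmxCK adj_diagC mulmxA.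
by [].
Qed.

Lemma opbound_diag_sin m (phi : 'rV[R]_m) : opbound (diagC (map_mx sin phi)) 1.
Proof.
by apply: opbound_diagC => // i; rewrite mxE ler_norml sin_geN1 sin_le1.
Qed.

(** Split U y, where y = U' u, by the projector V V'. Since V' U = Q cos(phi) P', the component in
    the range of V has norm ||cos(phi) z|| with z = P' y, so cos^2 + sin^2 = 1 leaves exactly
    ||sin(phi) z|| for the other one. *)
Lemma canonical_angles_bound n m (U V : 'M[C]_(n, m)) phi :
  U^t* *m U = 1%:M -> V^t* *m V = 1%:M -> canonical_angles U V phi ->
  opbound ((1%:M - V *m V^t*) *m (U *m U^t*)) (opnorm (diagC (map_mx sin phi))).
Proof.
move=> UU VV /canonical_angles_sym[_ [Q [P [Q1 P1 VU]]]] u.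
have sin_s := opnorm_opbound (opbound_diag_sin phi).
have := opnorm_ge0 (opbound_diag_sin phi); set s := opnorm _ => s0.
have /unitarymxP/mulmx1C Q'Q := Q1.
have PP' : P^t*^t* *m P^t* = 1%:M by rewrite trmxCK; apply/unitarymxP.
set y := U^t* *m u; have yu : vnorm y <= vnorm u.
  by have := opbound_isom_adj UU u; rewrite mul1r.
rewrite -!mulmxA -/y.
suff step : vnorm ((1%:M - V *m V^t*) *m (U *m y)) <= s * vnorm y.
  by apply: le_trans step _; rewrite ler_wpM2l.
have pyth := projector_pythagoras (U *m y) (isom_projector_adj V)
  (isom_projector_idem VV).
rewrite (vnorm_isom _ UU) -(mulmxA V) (vnorm_isom _ VV) in pyth.
rewrite [V^t* *m _]mulmxA VU -!(mulmxA Q) (vnorm_isom _ Q'Q) in pyth.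
rewrite -[_ *m P^t* *m y]mulmxA in pyth.
have yz : vnorm (P^t* *m y) = vnorm y := vnorm_isom y PP'.
move: (P^t* *m y) yz pyth => z yz.
have zE : vnorm y ^+ 2 = vnorm (diagC (map_mx cos phi) *m z) ^+ 2
    + vnorm (diagC (map_mx sin phi) *m z) ^+ 2.
  rewrite -yz !vnorm_diagC_sqr -big_split vnorm_sqr /=; apply: eq_bigr => i _.
  by rewrite !mxE -mulrDl cos2Dsin2 mul1r.
move=> /(etrans (esym zE))/addrI/eqP.
by rewrite eqrXn2 ?vnorm_ge0// => /eqP <-; rewrite -yz.
Qed.

End Adjoint.

(** * Chebyshev polynomials *)

Section Chebyshev.

(* [cheb_pair y w k] holds the coordinates (U, W) of (y + e)^k = U + e W, where
   e^2 = - w.  With w = h^2 - y^2, U is the Chebyshev polynomial h^k T_k(y/h);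
   this form stays meaningful at h = 0. *)
Fixpoint cheb_pair (S : comNzRingType) (y w : S) (k : nat) : S * S :=
  if k is k'.+1 then
    let p := cheb_pair y w k' in (y * p.1 - w * p.2, p.1 + y * p.2)
  else (1, 0).

Lemma cheb_pair_pell (S : comNzRingType) (y w : S) k :
  (cheb_pair y w k).1 ^+ 2 + w * (cheb_pair y w k).2 ^+ 2 = (y ^+ 2 + w) ^+ k.
Proof.
elim: k => [|k IHk] /=; first by rewrite expr1n expr0n mulr0 addr0.
by rewrite [RHS]exprS -IHk; ring.
Qed.

Lemma cheb_pair_exp (S : comNzRingType) (y w e : S) k : e ^+ 2 = - w ->
  (cheb_pair y w k).1 + e * (cheb_pair y w k).2 = (y + e) ^+ k.
Proof.
move=> e2; elim: k => [|k IHk] /=; first by rewrite mulr0 addr0.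
by rewrite [RHS]exprS -IHk -[w]opprK -e2; ring.
Qed.

Lemma horner_cheb_pair (S : comNzRingType) (y w : {poly S}) (x : S) k :
  ((cheb_pair y w k).1.[x], (cheb_pair y w k).2.[x]) =
  cheb_pair y.[x] w.[x] k.
Proof. by elim: k => [|k IHk] /=; rewrite -?IHk /= !hornerE. Qed.

Lemma size_mul_le (S : comNzRingType) (p q : {poly S}) a b :
  (size p <= a)%N -> (size q <= b)%N -> (size (p * q)%R <= (a + b).-1)%N.
Proof.
move=> pa qb; rewrite (leq_trans (size_polyMleq _ _))//.
by rewrite -!subn1 leq_sub2r// leq_add.
Qed.

Lemma size_cheb_pair (S : comNzRingType) (y w : {poly S}) k :
  (size y <= 2)%N -> (size w <= 3)%N ->
  (size (cheb_pair y w k).1 <= k.+1)%N /\ (size (cheb_pair y w k).2 <= k)%N.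
Proof.
move=> sy sw; elim: k => [|k [IHU IHW]] /=; first by rewrite size_poly1 size_poly0.
split; rewrite (leq_trans (size_polyD _ _))// geq_max.
  by rewrite size_polyN (size_mul_le sy IHU) (size_mul_le sw IHW).
by rewrite IHU (size_mul_le sy IHW).
Qed.

(** Take p = U / U(0) with y = g - x, where g and h are the midpoint and half-length of [a, b]. The
    Pell identity gives |U| <= h^k on [a, b], the power formula gives U(0) >= (g + e)^k / 2 with e =
    sqrt(ab), and h / (g + e) is the stated rate. *)
Lemma chebyshev_bound (R : rcfType) (a b : R) (k : nat) : 0 < a -> a <= b ->
  exists p : {poly R}, [/\ (size p <= k.+1)%N, p`_0 = 1 &
    forall x, a <= x <= b -> `|p.[x]| <= 2 * (1 - 2 / (1 + Num.sqrt (b / a))) ^+ k].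
Proof.
move=> a0 ab; have b0 : 0 < b by apply: lt_le_trans ab.
pose g := (a + b) / 2; pose h := (b - a) / 2.
pose y : {poly R} := g%:P - 'X; pose w : {poly R} := (h ^+ 2)%:P - y ^+ 2.
pose U := (cheb_pair y w k).1.
have sy : (size y <= 2)%N.
  by rewrite (leq_trans (size_polyD _ _))// size_polyN size_polyX geq_max
    (leq_trans (size_polyC_leq1 _)).
have sw : (size w <= 3)%N.
  rewrite (leq_trans (size_polyD _ _))// size_polyN geq_max.
  by rewrite (leq_trans (size_polyC_leq1 _))//= expr2 (size_mul_le sy sy).
have [sU _] := size_cheb_pair k sy sw.
have UE x : U.[x] = (cheb_pair (g - x) (h ^+ 2 - (g - x) ^+ 2) k).1.
  by have /(congr1 fst) /= := horner_cheb_pair y w x k; rewrite !hornerE.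
pose e := Num.sqrt a * Num.sqrt b.
have sa0 : 0 < Num.sqrt a by rewrite sqrtr_gt0.
have sb0 : 0 < Num.sqrt b by rewrite sqrtr_gt0.
have sa2 : Num.sqrt a ^+ 2 = a by rewrite sqr_sqrtr// ltW.
have sb2 : Num.sqrt b ^+ 2 = b by rewrite sqr_sqrtr// ltW.
have e2 : e ^+ 2 = - (h ^+ 2 - (g - 0) ^+ 2).
  by rewrite /e exprMn sa2 sb2 /h /g; field.
have eg : e <= g by have := sqr_ge0 (Num.sqrt a - Num.sqrt b); rewrite /e /g; nra.
have ge0 : 0 < g + e by rewrite /g /e; nra.
(* Adding the power formulas for e and -e gives 2 U(0) = (g + e)^k + (g - e)^k, and the last term is
   nonnegative. *)
have U0 : (g + e) ^+ k <= 2 * U.[0].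
  have Up := cheb_pair_exp (g - 0) k e2.
  have Um : (- e) ^+ 2 = - (h ^+ 2 - (g - 0) ^+ 2) by rewrite sqrrN.
  have {}Um := cheb_pair_exp (g - 0) k Um.
  have gek : 0 <= (g - e) ^+ k by rewrite exprn_ge0// subr_ge0.
  by move: Up Um; rewrite UE !subr0; nra.
have U00 : 0 < U.[0] by have := exprn_gt0 k ge0; lra.
have h0 : 0 <= h by rewrite /h; lra.
(* Both sides equal (sqrt b - sqrt a) / (sqrt b + sqrt a). *)
have ratio : 1 - 2 / (1 + Num.sqrt (b / a)) = h / (g + e).
  rewrite sqrtrM ?ltW// sqrtrV ?ltW//.
  have -> : h = (Num.sqrt b ^+ 2 - Num.sqrt a ^+ 2) / 2 by rewrite sa2 sb2.
  have -> : g + e = (Num.sqrt a + Num.sqrt b) ^+ 2 / 2.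
    by rewrite sqrrD sa2 sb2 /g /e; field.
  by field; rewrite !gt_eqF//= ?exprn_gt0 ?addr_gt0.
exists (U.[0]^-1 *: U); split.
- by rewrite (leq_trans (size_scale_leq _ _)).
- by rewrite coefZ -horner_coef0 mulVf// gt_eqF.
- move=> x /andP[ax xb]; rewrite hornerZ normrM ger0_norm ?invr_ge0 ?(ltW U00)//.
  have Ux : `|U.[x]| <= h ^+ k.
    rewrite -ler_sqr ?nnegrE ?exprn_ge0// real_normK ?num_real//.
    have := cheb_pair_pell (g - x) (h ^+ 2 - (g - x) ^+ 2) k.
    rewrite -UE [_ ^+ 2 + (_ - _)]addrC subrK exprAC => <-.
    by rewrite lerDl mulr_ge0 ?sqr_ge0// /g /h; nra.
  rewrite ratio expr_div_n mulrA mulrC ler_pdivrMr// mulrAC.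
  rewrite ler_pdivlMr ?exprn_gt0// (le_trans (ler_wpM2l (normr_ge0 _) U0))//.
  by rewrite mulrCA -!mulrA ler_pM2l// mulrC [leRHS]mulrC ler_pM2l.
Qed.

(** Squaring maps both intervals onto [a^2, b^2], where the square root in the rate becomes b / a.
    Composition with x^2 doubles the degree, hence the exponent [j./2]. *)
Lemma chebyshev_bound_sym (R : rcfType) (a b : R) (j : nat) : 0 < a -> a <= b ->
  exists p : {poly R}, [/\ (size p <= j.+1)%N, p`_0 = 1 &
    forall x, a <= `|x| <= b -> `|p.[x]| <= 2 * (1 - 2 / (1 + b / a)) ^+ j./2].
Proof.
move=> a0 ab; have b0 : 0 < b by apply: lt_le_trans ab.
have ab2 : a ^+ 2 <= b ^+ 2 by rewrite lerXn2r ?nnegrE// ltW.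
have [p [sp p0 ple]] := chebyshev_bound j./2 (exprn_gt0 2 a0) ab2.
exists (p \Po 'X^2); split.
- rewrite (leq_trans (size_comp_poly_leq _ _))// size_polyXn /= ltnS.
  rewrite (@leq_trans (j./2 * 2))%N//; last by rewrite muln2 halfK leq_subr.
  by rewrite leq_mul2r /= -ltnS; case: (size p) sp => //.
- by rewrite -horner_coef0 horner_comp hornerXn expr0n /= horner_coef0.
- move=> x /andP[ax xb]; rewrite horner_comp hornerXn.
  have := ple (x ^+ 2); rewrite -expr_div_n sqrtr_sqr [`|b / a|]ger0_norm; last first.
    by rewrite divr_ge0// ltW.
  apply; rewrite -[x ^+ 2]real_normK ?num_real//.
  by rewrite !lerXn2r ?nnegrE// ?(ltW a0) ?(ltW b0).
Qed.

End Chebyshev.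

(** * Ordered eigenvalues *)

Section EigenvalueOrder.
Variable R : realType.
Implicit Type s : seq R.

Lemma sort_ge_nth s i j : (i <= j < size s)%N ->
  (sort (fun a b => b <= a) s)`_j <= (sort (fun a b => b <= a) s)`_i.
Proof.
set r := fun a b : R => b <= a => /andP[ij js].
have ss : sorted r (sort r s) by apply: sort_sorted => x y; apply: le_total.
apply: (sorted_leq_nth _ _ 0 ss) => //.
- by move=> y x z yx zy; apply: le_trans zy yx.
- by move=> x; rewrite /r lexx.
- by rewrite inE size_sort (leq_ltn_trans ij).
- by rewrite inE size_sort.
Qed.

Lemma ith_largest1_ge s x : x \in s -> x <= ith_largest s 1.
Proof.
rewrite -(mem_sort (fun a b => b <= a)) => /(nthP 0)[l].
by rewrite size_sort => l_s <-; apply: sort_ge_nth.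
Qed.

Lemma ith_largest_mem s i : (i.-1 < size s)%N -> ith_largest s i \in s.
Proof.
by move=> i_s; rewrite -(mem_sort (fun a b => b <= a)) mem_nth// size_sort.
Qed.

(** In decreasing order the entries from index m on do not exceed the one at index m, so only the
    first m can. *)
Lemma count_gt_ith_largest s m : (m < size s)%N ->
  (count (fun x : R => (ith_largest s m.+1 < x)%R) s <= m)%N.
Proof.
move=> ms; set t := sort (fun a b => b <= a) s.
have pst : perm_eq s t by rewrite perm_sym perm_sort.
rewrite (permP pst) -(cat_take_drop m t) count_cat.
have -> : count (fun x => ith_largest s m.+1 < x) (drop m t) = 0%N.
  apply/eqP; rewrite -leqn0 leqNgt -has_count; apply/hasPn => x.
  move=> /(nthP 0)[l]; rewrite size_drop nth_drop size_sort ltn_subRL => l_s <-.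
  by rewrite -leNgt sort_ge_nth ?leq_addr.
by rewrite addn0 (leq_trans (count_size _ _))// size_take_min geq_minl.
Qed.

Lemma count_ge_ith_largest s m : (m < size s)%N ->
  (m < count (fun x : R => (ith_largest s m.+1 <= x)%R) s)%N.
Proof.
move=> ms; set t := sort (fun a b => b <= a) s.
have pst : perm_eq s t by rewrite perm_sym perm_sort.
rewrite (permP pst) -(cat_take_drop m.+1 t) count_cat ltn_addr//.
have -> : count (fun x => ith_largest s m.+1 <= x) (take m.+1 t) = m.+1.
  rewrite (_ : count _ _ = size (take m.+1 t)).
    by rewrite size_take_min size_sort; apply/minn_idPl.
  apply/eqP; rewrite -all_count; apply/(all_nthP 0) => i.
  rewrite size_take_min size_sort leq_min => /andP[im i_s].
  by rewrite nth_take// sort_ge_nth// -ltnS im.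
by [].
Qed.

(** Reflection through 0, which lets case (ii) reuse the ordering facts of case (i). *)
Lemma ith_smallest_opp s i :
  (i.-1 < size s)%N -> ith_smallest s i = - ith_largest [seq - x | x <- s] i.
Proof.
move=> i_s; rewrite /ith_largest sort_map (nth_map 0) ?size_sort// opprK.
rewrite /ith_smallest; congr (nth _ (sort _ s) _).
by apply/funext => x; apply/funext => y; rewrite /= lerN2.
Qed.

Lemma ith_smallest1_le s x : x \in s -> ith_smallest s 1 <= x.
Proof.
move=> xs; rewrite ith_smallest_opp; last by case: s xs.
by rewrite lerNl ith_largest1_ge// map_f.
Qed.

(** * Position of the target relative to the extreme eigenvalues *)

Section Target.
Variables (s : seq R) (tau : R) (m : nat).
Hypothesis ms : (m < size s)%N.
Hypothesis s_sorted : sorted (fun a b => `|a - tau| <= `|b - tau|) s.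

Lemma dist_target_le i j : (i <= j < size s)%N -> `|s`_i - tau| <= `|s`_j - tau|.
Proof.
move=> /andP[ij js]; apply: (sorted_leq_nth _ _ 0 s_sorted) => //.
- by move=> y x z /= xy; apply: le_trans.
- by rewrite inE (leq_ltn_trans ij).
Qed.

(** Let L be the (m+1)th largest entry. As tau lies beyond the midpoint of L and the maximum, every
    entry above L is strictly closer to tau than L is. Comparing the two orderings is then a matter
    of counting the entries above L or equal to it. *)
Lemma target_above_largest :
  (ith_largest s 1 + ith_largest s m.+1) / 2 < tau ->
  [/\ ith_largest s m.+1 < tau,
      `|s`_m - tau| <= tau - ith_largest s m.+1 &
      forall i, (m <= i < size s)%N -> s`_i <= ith_largest s m.+1].
Proof.
set L := ith_largest s m.+1; set lmax := ith_largest s 1 => mid.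
have L_lmax : L <= lmax by apply: sort_ge_nth.
have L_tau : L < tau by lra.
split=> //.
  (* More than m entries reach L, so one of them lies outside the m entries closest to tau. *)
  have : has (fun x => L <= x) (drop m s).
    rewrite has_count -(ltn_add2l (count (fun x => L <= x) (take m s))) addn0.
    rewrite -count_cat cat_take_drop; apply: leq_ltn_trans (count_ge_ith_largest ms).
    by rewrite (leq_trans (count_size _ _))// size_take_min geq_minl.
  case/(has_nthP 0) => i; rewrite size_drop nth_drop ltn_subRL => i_s Li.
  have mi : `|s`_m - tau| <= `|s`_(m + i) - tau|.
    by rewrite dist_target_le ?leq_addr.
  have li : s`_(m + i) <= lmax by rewrite ith_largest1_ge ?mem_nth.
  by rewrite (le_trans mi)// ler_norml; lra.
move=> i /andP[mi i_s]; rewrite leNgt; apply/negP => Li.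
suff : (m < count (fun x : R => (L < x)%R) s)%N by rewrite ltnNge count_gt_ith_largest.
have li : s`_i <= lmax by rewrite ith_largest1_ge ?mem_nth.
have di : `|s`_i - tau| < tau - L by rewrite ltr_norml; lra.
rewrite -[s in count _ s](cat_take_drop m) count_cat.
(* The first m entries are no further from tau than [s]_i[, hence also above L; with]s[_i] itself
   that makes more than m. *)
have -> : count (fun x => L < x) (take m s) = m.
  have sz : size (take m s) = m by rewrite size_takel// ltnW.
  rewrite -[RHS]sz; apply/eqP; rewrite -all_count; apply/(all_nthP 0) => l.
  rewrite sz => lm; rewrite nth_take//.
  have : `|s`_l - tau| <= `|s`_i - tau|.
    by rewrite dist_target_le// i_s (leq_trans (ltnW lm)).
  by move=> /le_lt_trans/(_ di); rewrite ltr_norml; lra.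
rewrite -[ltnLHS]addn0 ltn_add2l -has_count; apply/hasP; exists s`_i => //.
by rewrite -(subnKC mi) -nth_drop mem_nth// size_drop ltn_sub2r.
Qed.

End Target.
End EigenvalueOrder.

(** * Eigenvalues of the compressed operator and MINRES *)

Section CompressedEigenvalue.
Variables (R : realType) (n m : nat).
Local Notation C := R[i].

(** The projector E: in the eigenbasis of A the range of X_m is spanned by the first m coordinate
    vectors. *)
Definition head_proj : 'M[C]_n := diagC (\row_(i < n) (i < m)%N%:R).

Lemma head_proj_adj : head_proj^t* = head_proj.
Proof. exact: adj_diagC. Qed.

Lemma head_proj_comm (d : 'rV[R]_n) (x : 'cV[C]_n) :
  head_proj *m (diagC d *m x) = diagC d *m (head_proj *m x).
Proof. by apply/colP => i; rewrite !diagC_mul mulrCA. Qed.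

Lemma head_proj_idem : head_proj *m head_proj = head_proj.
Proof.
rewrite /head_proj /diagC mulmx_diag; congr diag_mx; apply/rowP => i.
by rewrite !mxE -rmorphM -natrM mulnb andbb.
Qed.

Lemma vnorm_head_sqr (x : 'cV[C]_n) : vnorm (head_proj *m x) ^+ 2 =
  \sum_(i < n) (i < m)%N%:R * Normc.normc (x i 0) ^+ 2.
Proof.
rewrite vnorm_diagC_sqr; apply: eq_bigr => i _.
by rewrite mxE -natrX; case: (i < m)%N.
Qed.

Definition tail_proj : 'M[C]_n := 1%:M - head_proj.

Lemma tail_proj_adj : tail_proj^t* = tail_proj.
Proof. by rewrite adj1B head_proj_adj. Qed.

Lemma tail_proj_idem : tail_proj *m tail_proj = tail_proj.
Proof. exact: projector_compl_idem head_proj_idem. Qed.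

Lemma tail_proj_comm (d : 'rV[R]_n) (x : 'cV[C]_n) :
  tail_proj *m (diagC d *m x) = diagC d *m (tail_proj *m x).
Proof. by rewrite !mulmxBl !mul1mx mulmxBr head_proj_comm. Qed.

Lemma tail_projE (x : 'cV[C]_n) (i : 'I_n) :
  (tail_proj *m x) i 0 = (m <= i)%N%:R * x i 0.
Proof.
rewrite mulmxBl mul1mx mxE [in X in _ + X]mxE diagC_mul mxE [(m <= i)%N]leqNgt.
by case: (i < m)%N; rewrite ?rmorph0 ?rmorph1 ?mul1r ?mul0r ?subrr ?subr0.
Qed.

Variables (mu : 'rV[R]_n) (M s : R) (F : 'M[C]_n).
Hypotheses (mu_le : forall i, `|mu 0 i| <= M) (s_ge0 : 0 <= s).
Hypotheses (F_adj : F^t* = F) (F_idem : F *m F = F).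
Hypothesis head_bound : opbound (head_proj *m (1%:M - F)) s.
Hypothesis tail_bound : opbound (tail_proj *m F) s.
Variables (v : 'cV[C]_n) (beta : R).
Hypotheses (v_neq0 : v != 0) (Fv : F *m v = 0).
Hypothesis v_eigen : (1%:M - F) *m (diagC mu *m v) = beta%:C *: v.

Let Pv : (1%:M - F) *m v = v.
Proof. by rewrite mulmxBl mul1mx Fv subr0. Qed.

Let v_gt0 : 0 < vnorm v. Proof. by rewrite vnorm_gt0. Qed.

(** The self-adjoint projector 1 - F fixes v, so it can be moved off diag(mu) v in the inner product
    with v. *)
Lemma compressed_rayleigh :
  beta * vnorm v ^+ 2 = \sum_i mu 0 i * Normc.normc (v i 0) ^+ 2.
Proof.
apply: complexI; rewrite rmorphM /= -dotvv -dotZr -v_eigen dot_adj adj1B F_adj Pv.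
rewrite dotE rmorph_sum /=; apply: eq_bigr => i _.
by rewrite diagC_mul [RHS]rmorphM /= normc_sqrE mulrCA.
Qed.

Lemma head_small : vnorm (head_proj *m v) <= s * vnorm v.
Proof. by have := head_bound v; rewrite -mulmxA Pv. Qed.

Lemma compressed_le (eps b : R) :
  (forall i, eps * mu 0 i <= b) -> eps * beta <= b.
Proof.
move=> mu_b; rewrite -(ler_pM2r (exprn_gt0 2 v_gt0)) -mulrA compressed_rayleigh.
rewrite mulr_sumr vnorm_sqr mulr_sumr ler_sum// => i _.
by rewrite mulrA ler_wpM2r ?sqr_ge0.
Qed.

(** In the Rayleigh quotient a tail entry of eps mu is at least a and a head entry at least -M = a -
    (a + M). The loss is (a + M) ||E v||^2, at most 2 M s^2 ||v||^2. *)
Lemma compressed_ge_definite (eps a : R) : `|eps| = 1 -> 0 <= a <= M ->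
  (forall i : 'I_n, (m <= i)%N -> a <= eps * mu 0 i) ->
  a - 2 * M * s ^+ 2 <= eps * beta.
Proof.
move=> eps1 /andP[a0 aM] a_mu; set N := vnorm v ^+ 2.
have N0 : 0 < N by rewrite exprn_gt0.
have headN : vnorm (head_proj *m v) ^+ 2 <= s ^+ 2 * N.
  by rewrite /N -exprMn lerXn2r ?nnegrE ?mulr_ge0 ?vnorm_ge0 ?head_small.
rewrite -(ler_pM2r N0) -[leRHS]mulrA compressed_rayleigh.
have : a * N - (a + M) * vnorm (head_proj *m v) ^+ 2 <=
    eps * (\sum_i mu 0 i * Normc.normc (v i 0) ^+ 2).
  rewrite vnorm_head_sqr /N vnorm_sqr !mulr_sumr -sumrB ler_sum// => i _.
  rewrite [eps * _]mulrA [(a + M) * _]mulrA -mulrBl ler_wpM2r ?sqr_ge0//.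
  have [im|mi] := ltnP i m; last by rewrite mulr0 subr0 a_mu.
  rewrite mulr1 opprD addrA subrr add0r; have := mu_le i.
  by rewrite -[`|mu 0 i|]mul1r -eps1 -normrM ler_norml => /andP[].
have : (a + M) * vnorm (head_proj *m v) ^+ 2 <= 2 * M * (s ^+ 2 * N).
  by apply: ler_pM => //; [rewrite addr_ge0// (le_trans a0)|rewrite sqr_ge0|lra].
by move: (vnorm _ ^+ 2) (\sum_i _) => h X; lra.
Qed.

(* Test vector: z = sgn(diag mu) applied to the tail of v; it nearly satisfies
   F z = 0, and <z, diag(mu) v> = sum of |mu_i| |v_i|^2 over the tail. *)
Lemma compressed_ge_indefinite (g : R) : 0 <= g ->
  (forall i : 'I_n, (m <= i)%N -> g <= `|mu 0 i|) ->
  s ^+ 2 <= 3 / 4 -> g - 3 * M * s ^+ 2 <= `|beta|.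
Proof.
move=> g0 g_mu s34.
have [t tE] : exists t, t = tail_proj *m v by exists (tail_proj *m v).
have [z zE] : exists z, z = diagC (map_mx Num.sg mu) *m t.
  by exists (diagC (map_mx Num.sg mu) *m t).
set b := vnorm t.
have M0 : 0 <= M.
  have /existsP[i _] : [exists i : 'I_n, true].
    apply: contraR v_neq0; rewrite negb_exists => /forallP no.
    by apply/eqP/colP => i; have := no i.
  exact: le_trans (mu_le i).
have b0 : 0 <= b by apply: vnorm_ge0.
have Et : tail_proj *m t = t by rewrite tE mulmxA tail_proj_idem.
have Ez : tail_proj *m z = z by rewrite zE tail_proj_comm Et.
have zb : vnorm z <= b.
  apply: le_vnorm => i; rewrite zE diagC_mul mxE Normc.normcM normc_real.
  by rewrite normr_sg ler_piMl ?normc_ge0// lern1 leq_b1.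
have Fz : vnorm (F *m z) <= s * b.
  have := opbound_adj s_ge0 tail_bound z; rewrite adjM tail_proj_adj F_adj.
  by rewrite -mulmxA Ez => Fz; apply: (le_trans Fz); apply: ler_wpM2l.
have hFz : vnorm (head_proj *m (F *m z)) <= s * b.
  exact: le_trans (projector_contract _ head_proj_adj head_proj_idem) Fz.
(* Writing F z = F (F z) gains a second factor s. *)
have tFz : vnorm (tail_proj *m (F *m z)) <= s ^+ 2 * b.
  have := tail_bound (F *m z); rewrite -mulmxA [F *m (F *m z)]mulmxA F_idem => tF.
  by apply: (le_trans tF); rewrite expr2 -mulrA; apply: ler_wpM2l.
have split_dot w : dot w (diagC mu *m v) =
    dot (head_proj *m w) (diagC mu *m (head_proj *m v)) +
    dot (tail_proj *m w) (diagC mu *m t).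
  rewrite -(dot_selfadj w _ head_proj_adj) -(dot_selfadj w _ tail_proj_adj).
  rewrite head_proj_comm tail_proj_comm Et (mulmxA head_proj) head_proj_idem.
  by rewrite -dotDr -mulmxDr tE mulmxBl mul1mx subrKC.
have mu_op : opbound (diagC mu) M by apply: opbound_diagC.
(* Split diag(mu) v into its (1 - F) part, which is beta v, and its F part. *)
have dot_z : dot z (diagC mu *m v) =
    beta%:C * dot z v + dot (F *m z) (diagC mu *m v).
  rewrite -dotZr -v_eigen -(dot_selfadj z _ F_adj) -dotDr.
  by rewrite -mulmxDl subrK mul1mx.
have dot_zv : dot z v = dot z t by rewrite -{1}Ez -(dot_selfadj z _ tail_proj_adj) -tE.
(* The error <F z, diag(mu) v> is second order in s: on the head both F z and v are of order s, on
   the tail F z is of order s^2. *)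
have upper : Normc.normc (dot z (diagC mu *m v)) <=
    `|beta| * b ^+ 2 + (M * s ^+ 2 * b * vnorm v + M * s ^+ 2 * b ^+ 2).
  rewrite dot_z split_dot dot_zv (le_trans (normcD_le _ _))// lerD//.
    rewrite Normc.normcM normc_real ler_wpM2l//.
    by rewrite (le_trans (dot_cauchy_schwarz _ _))// expr2 ler_wpM2r.
  rewrite (le_trans (normcD_le _ _))// lerD//.
    rewrite (le_trans (dot_cauchy_schwarz _ _))//.
    rewrite (le_trans (ler_pM (vnorm_ge0 _) (vnorm_ge0 _) hFz (mu_op _)))//.
    rewrite [leRHS](_ : _ = s * b * M * (s * vnorm v)); last by ring.
    rewrite [leLHS]mulrA ler_wpM2l ?mulr_ge0//; exact: head_small.
  rewrite (le_trans (dot_cauchy_schwarz _ _))//.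
  rewrite (le_trans (ler_pM (vnorm_ge0 _) (vnorm_ge0 _) tFz (mu_op _)))// -/b.
  by rewrite [leRHS](_ : _ = s ^+ 2 * b * (M * b)) //; ring.
have lower : g * b ^+ 2 <= Normc.normc (dot z (diagC mu *m v)).
  have -> : dot z (diagC mu *m v) =
      (\sum_(i < n) `|mu 0 i| * Normc.normc (t i 0) ^+ 2)%:C.
    rewrite -{1}Ez -(dot_selfadj z _ tail_proj_adj) tail_proj_comm -tE zE.
    rewrite -(dot_selfadj t _ (adj_diagC _)).
    rewrite dotE rmorph_sum /=; apply: eq_bigr => i _.
    rewrite !diagC_mul mxE mulrA -rmorphM /= -normrEsg mulrCA -normc_sqrE.
    by rewrite -rmorphM.
  rewrite normc_real (le_trans _ (ler_norm _))// vnorm_sqr mulr_sumr ler_sum// => i _.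
  have [im|mi] := ltnP i m; last by rewrite ler_wpM2r ?sqr_ge0 ?g_mu.
  rewrite tE tail_projE leqNgt im mul0r Normc.normc0 expr0n !mulr0.
  by [].
(* ||v||^2 = ||E v||^2 + b^2 <= (3/4) ||v||^2 + b^2. The two error terms become 2 M s^2 b^2 and M
   s^2 b^2, which is the origin of the constant 3. *)
have vb : vnorm v <= 2 * b.
  have := projector_pythagoras v head_proj_adj head_proj_idem.
  have := head_small; have := vnorm_ge0 (head_proj *m v).
  rewrite -/tail_proj -tE -/b; move: (vnorm (head_proj *m v)) => h h0 hs pyth.
  have hs2 : h ^+ 2 <= s ^+ 2 * vnorm v ^+ 2.
    by rewrite -exprMn lerXn2r ?nnegrE ?mulr_ge0 ?vnorm_ge0.
  have sv : s ^+ 2 * vnorm v ^+ 2 <= 3 / 4 * vnorm v ^+ 2.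
    by rewrite ler_wpM2r ?sqr_ge0.
  rewrite -ler_sqr ?nnegrE ?mulr_ge0 ?vnorm_ge0// exprMn; lra.
have bgt0 : 0 < b by have := v_gt0; lra.
have mid := le_trans lower upper.
have : M * s ^+ 2 * b * vnorm v <= M * s ^+ 2 * b * (2 * b).
  by rewrite ler_wpM2l// !mulr_ge0// sqr_ge0.
move=> mid2; rewrite -(ler_pM2r (exprn_gt0 2 bgt0)); nra.
Qed.

End CompressedEigenvalue.

(** * Polynomial bounds for MINRES on Hermitian systems *)

Section Minres.
Variable R : realType.
Local Notation C := R[i].

(** In a unitary eigenbasis p(B) r has coordinates p(d_l) times those of r. Only eigenvectors not
    orthogonal to r count: this keeps out the range of Xt_m, which the projected matrix sends to 0,
    where p = 1. *)
Lemma hermitian_polynomial_bound n (B : 'M[C]_n) (r : 'cV[C]_n) (p : {poly R}) c :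
  B \is hermsymmx -> 0 <= c ->
  (forall (beta : R) v, v != 0 -> B *m v = beta%:C *: v -> dot v r != 0 ->
     `|p.[beta]| <= c) ->
  vnorm (\sum_(i < size p) (p`_i)%:C *: (B ^+ i *m r)) <= c * vnorm r.
Proof.
move=> Bh c0 p_le; set W := spectralmx B.
have /orthomx_spectralP := hermitian_normalmx Bh.
have /mxOverP sp_real := hermitian_spectral_diag_real Bh.
have W1 : W \is unitarymx := spectral_unitarymx B.
rewrite -/W invmx_unitary//; set sp := spectral_diag B => BE.
have WW' : W *m W^t* = 1%:M by apply/unitarymxP.
have W'W : W^t* *m W = 1%:M := mulmx1C WW'.
have [d spE] : exists d : 'rV[R]_n, diag_mx sp = diagC d.
  exists (\row_i complex.Re (sp 0 i)); congr diag_mx; apply/rowP => i.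
  by rewrite !mxE RRe_real.
rewrite spE in BE.
have WB i : W *m (B ^+ i *m r) = \col_l ((d 0 l ^+ i)%:C * (W *m r) l 0).
  elim: i => [|i IHi].
    by apply/colP => l; rewrite mul1mx [RHS]mxE expr0 mul1r.
  rewrite exprS -[B * _]/(B *m _) {1}BE -!mulmxA [W *m (W^t* *m _)]mulmxA WW' mul1mx.
  rewrite IHi; apply/colP => l; rewrite diagC_mul !mxE exprS mulrA.
  by rewrite -rmorphM.
rewrite -(vnorm_isom _ W'W) -(vnorm_isom r W'W).
have -> : c * vnorm (W *m r) = vnorm (c%:C *: (W *m r)).
  by rewrite vnormZ normc_real ger0_norm.
apply: le_vnorm => l; rewrite [in leRHS]mxE Normc.normcM normc_real (ger0_norm c0).
have -> : (W *m (\sum_(i < size p) (p`_i)%:C *: (B ^+ i *m r))) l 0 =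
    (p.[d 0 l])%:C * (W *m r) l 0.
  rewrite mulmx_sumr summxE horner_coef rmorph_sum /= mulr_suml.
  apply: eq_bigr => i _; rewrite -scalemxAr mxE WB mxE mulrA; congr (_ * _).
  by rewrite -rmorphM.
rewrite Normc.normcM normc_real.
have [->|Wr0] := eqVneq ((W *m r) l 0) 0; first by rewrite Normc.normc0 !mulr0.
rewrite ler_wpM2r ?normc_ge0//.
have WrE : (W *m r) l 0 = dot (col l (W^t*)) r.
  by rewrite /dot mxE [RHS]mxE; apply: eq_bigr => i _; rewrite !mxE conjCK.
apply: (p_le _ (col l (W^t*))); last by rewrite -WrE.
- by apply: contraNneq Wr0 => w0; rewrite WrE w0 /dot trmx0 map_mx0 mul0mx mxE.
- rewrite colE BE -!mulmxA [W *m (_ *m _)]mulmxA WW' mul1mx.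
  rewrite [RHS]scalemxAr; congr (_ *m _); apply/colP => i.
  rewrite diagC_mul !mxE; have [->//|_] := eqVneq i l.
  by rewrite !mulr0.
Qed.

Lemma minres_polynomial_bound n (B : 'M[C]_n) (r t : 'cV[C]_n) j (p : {poly R}) c :
  B \is hermsymmx -> minres_iterate B r j t -> (size p <= j.+1)%N -> p`_0 = 1 ->
  (forall (beta : R) v, v != 0 -> B *m v = beta%:C *: v -> dot v r != 0 ->
     `|p.[beta]| <= c) -> 0 <= c ->
  vnorm (B *m t + r) <= c * vnorm r.
Proof.
move=> Bh [_ t_min] sp p0 p_le c0.
(* Since p(0) = 1, p(B) r = r + B u with u in the Krylov space. *)
pose u := \sum_(i < j) (p`_i.+1)%:C *: (B ^+ i *m r).
apply: le_trans (t_min u _) _; first by exists (fun i => (p`_i.+1)%:C).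
apply: le_trans (hermitian_polynomial_bound Bh c0 p_le).
rewrite (_ : B *m u + r = \sum_(i < size p) (p`_i)%:C *: (B ^+ i *m r))//.
rewrite (big_ord_widen _ (fun i => (p`_i)%:C *: (B ^+ i *m r)) sp) big_mkcond /=.
rewrite big_ord_recl /= p0 expr0 mul1mx scale1r addrC lt0n size_poly_eq0.
have -> /= : p != 0 by apply: contra_eq_neq p0 => ->; rewrite coef0 eq_sym oner_eq0.
congr (_ + _); rewrite mulmx_sumr; apply: eq_bigr => i _.
rewrite -scalemxAr mulmxA -[B *m B ^+ i]/(B * B ^+ i) -exprS.
case: ltnP => // ip; rewrite (nth_default 0 ip) rmorph0 scale0r.
by [].
Qed.

End Minres.

(** * Convergence rates and passage to the eigenbasis of A *)

Section CorrectionEquation.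
Variable R : realType.
Local Notation C := R[i].

(** Composing p with [eps *: 'X] moves the spectrum into [a, b] without raising the degree or
    changing p(0). *)
Lemma minres_definite_bound n (B : 'M[C]_n) (r t : 'cV[C]_n) j (eps a b : R) :
  B \is hermsymmx -> minres_iterate B r j t -> 0 < a -> a <= b ->
  (forall (beta : R) v, v != 0 -> B *m v = beta%:C *: v -> dot v r != 0 ->
     a <= eps * beta <= b) ->
  vnorm (B *m t + r) <= 2 * (1 - 2 / (1 + Num.sqrt (b / a))) ^+ j * vnorm r.
Proof.
move=> Bh t_min a0 ab spec; have [p [sp p0 ple]] := chebyshev_bound j a0 ab.
apply: (@minres_polynomial_bound _ _ _ _ _ _ (p \Po (eps *: 'X)) _ Bh t_min).
- apply: (leq_trans (size_comp_poly_leq _ _)); rewrite ltnS.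
  have sX : leq (size (eps *: 'X : {poly R})).-1 1.
    by rewrite -subn1 leq_subLR (leq_trans (size_scale_leq _ _))// size_polyX.
  apply: (leq_trans (leq_mul (leqnn _) sX)).
  by rewrite muln1 -subn1 leq_subLR add1n.
- by rewrite -horner_coef0 horner_comp hornerZ hornerX mulr0 horner_coef0.
- move=> beta v v0 Bv vr; rewrite horner_comp hornerZ hornerX.
  exact: ple (spec _ _ v0 Bv vr).
- by apply: le_trans (ple a _); rewrite ?normr_ge0 ?lexx.
Qed.

Lemma minres_indefinite_bound n (B : 'M[C]_n) (r t : 'cV[C]_n) j (a b : R) :
  B \is hermsymmx -> minres_iterate B r j t -> 0 < a -> a <= b ->
  (forall (beta : R) v, v != 0 -> B *m v = beta%:C *: v -> dot v r != 0 ->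
     a <= `|beta| <= b) ->
  vnorm (B *m t + r) <= 2 * (1 - 2 / (1 + b / a)) ^+ j./2 * vnorm r.
Proof.
move=> Bh t_min a0 ab spec; have [p [sp p0 ple]] := chebyshev_bound_sym j a0 ab.
apply: (minres_polynomial_bound Bh t_min sp p0).
- by move=> beta v v0 Bv vr; apply: ple (spec _ _ v0 Bv vr).
- by apply: le_trans (ple a _); rewrite ?normr_ge0// ger0_norm ?lexx// ltW.
Qed.

Lemma first_colsM n p m k (mk : (m <= k)%N) (M : 'M[C]_(n, p)) (N : 'M[C]_(p, k)) :
  first_cols mk (M *m N) = M *m first_cols mk N.
Proof. by apply/matrixP => i l; rewrite !mxE; apply: eq_bigr => x _; rewrite mxE. Qed.

Lemma first_cols1 n m (mn : (m <= n)%N) :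
  first_cols mn (1%:M : 'M[C]_n) = pid_mx m.
Proof.
apply/matrixP => i l; rewrite !mxE -val_eqE /=.
by case: eqP => //= ->; rewrite ltn_ord.
Qed.

Lemma first_cols1_projector n m (mn : (m <= n)%N) :
  first_cols mn (1%:M : 'M[C]_n) *m (first_cols mn 1%:M)^t* = head_proj R n m.
Proof.
rewrite first_cols1 tr_pid_mx map_pid_mx mul_pid_mx !minnn.
apply/matrixP => i l; rewrite !mxE -[in RHS]val_eqE /=.
by case: eqP => _; case: (i < m)%N; rewrite /= ?mulr0n ?mulr1n ?rmorph0.
Qed.

Lemma first_cols_isom n m k (mk : (m <= k)%N) (M : 'M[C]_(n, k)) :
  M^t* *m M = 1%:M -> (first_cols mk M)^t* *m first_cols mk M = 1%:M.
Proof.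
move=> MM; rewrite -[M]mulmx1 first_colsM adjM mulmxA -(mulmxA _ _ M) MM mulmx1.
by rewrite first_cols1 tr_pid_mx map_pid_mx mul_pid_mx minnn (minn_idPr mk) pid_mx_1.
Qed.

(** The witness is X' (1 - K) v rather than X' v, as v need not lie in ker K. It is nonzero because
    <(1 - K) v, r> = <v, r>. *)
Lemma correction_eigenvector n (A X K : 'M[C]_n) (mu : 'rV[R]_n) (beta : R)
    (r v : 'cV[C]_n) :
  X^t* *m X = 1%:M -> A = X *m diagC mu *m X^t* ->
  K^t* = K -> K *m K = K -> K *m r = 0 ->
  (1%:M - K) *m A *m (1%:M - K) *m v = beta%:C *: v -> dot v r != 0 ->
  exists w : 'cV[C]_n, [/\ w != 0, X^t* *m K *m X *m w = 0 &
    (1%:M - X^t* *m K *m X) *m (diagC mu *m w) = beta%:C *: w].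
Proof.
move=> XX AE Kadj KK Kr.
have PP : (1%:M - K) *m (1%:M - K) = 1%:M - K := projector_compl_idem KK.
have Padj : (1%:M - K)^t* = 1%:M - K by rewrite adj1B Kadj.
have Pr : (1%:M - K) *m r = r by rewrite mulmxBl mul1mx Kr subr0.
have KP : K *m (1%:M - K) = 0 by rewrite mulmxBr mulmx1 KK subrr.
have FP : 1%:M - X^t* *m K *m X = X^t* *m (1%:M - K) *m X.
  by rewrite mulmxBr mulmx1 mulmxBl XX.
rewrite FP; move: (1%:M - K) PP Padj Pr KP {FP} => P PP Padj Pr KP Bv vr.
have XX' := mulmx1C XX.
exists (X^t* *m (P *m v)); split.
- apply: contraNneq vr => w0; rewrite -Pr (dot_selfadj _ _ Padj).
  by rewrite -[P *m v]mul1mx -XX' -mulmxA w0 mulmx0 /dot trmx0 map_mx0 mul0mx mxE.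
- rewrite -!mulmxA [X *m (X^t* *m _)]mulmxA XX' mul1mx [K *m (P *m v)]mulmxA KP.
  by rewrite mul0mx mulmx0.
- have -> : X^t* *m P *m X *m (diagC mu *m (X^t* *m (P *m v))) =
      X^t* *m (P *m A *m P *m v) by rewrite AE !mulmxA.
  have <- : P *m (P *m A *m P *m v) = P *m A *m P *m v by rewrite !mulmxA PP.
  by rewrite Bv -!scalemxAr.
Qed.

End CorrectionEquation.

(* lambda_i is lambda`_i.-1: tuples are indexed from 0. *)
Theorem theorem3p4 (R : realType) (n m k : nat)
  (m_gt0 : (0 < m)%N) (lt_mn : (m < n)%N) (le_mk : (m <= k)%N)
  (* the Hermitian matrix, its eigendecomposition and the target *)
  (A X : 'M[R[i]]_n) (lambda : n.-tuple R) (tau : R)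
  (A_herm : A \is hermsymmx)
  (X_unitary : X \is unitarymx)
  (A_eigen : A = X *m diagC (\row_i tnth lambda i) *m X^t*)
  (lambda_sorted : sorted (fun a b => `|a - tau| <= `|b - tau|) lambda)
  (lambda_gap : `|lambda`_m.-1 - tau| < `|lambda`_m - tau|)
  (* the Ritz pairs *)
  (Xt : 'M[R[i]]_(n, k)) (S : 'M[R[i]]_k) (theta : k.-tuple R)
  (Xt_orthonormal : Xt^t* *m Xt = 1%:M)
  (S_orthonormal : S^t* *m S = 1%:M)
  (ritz : forall i : 'I_k,
    (Xt^t* *m A *m Xt) *m col i S = (tnth theta i)%:C *: col i S)
  (theta_sorted : sorted (fun a b => `|a - tau| <= `|b - tau|) theta)
  (* the canonical angles between the ranges of Xt_m and X_m *)
  (phi : 'rV[R]_m)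
  (phi_angles : canonical_angles (first_cols le_mk (Xt *m S))
                                 (first_cols (ltnW lt_mn) X) phi)
  (j : nat) (t : 'cV[R[i]]_n) (j_range : (1 <= j <= n - m)%N) :
  let Xtm := first_cols le_mk (Xt *m S) in
  let xt1 := col (Ordinal (leq_trans m_gt0 le_mk)) (Xt *m S) in
  let r1 := A *m xt1 - (theta`_0)%:C *: xt1 in
  let B := (1%:M - Xtm *m Xtm^t*) *m (A - (tau%:C)%:M)
             *m (1%:M - Xtm *m Xtm^t*) in
  let rin := B *m t + r1 in
  let delta := 3 * `|lambda`_n.-1 - tau| * opnorm (diagC (map_mx sin phi)) ^+ 2 in
  let lmax := ith_largest lambda 1 in
  let lmax_m1 := ith_largest lambda m.+1 in
  let lmin := ith_smallest lambda 1 in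
  let lmin_m1 := ith_smallest lambda m.+1 in
  r1 != 0 ->
  minres_iterate B r1 j t ->
  delta < `|lambda`_m - tau| ->
  [/\ (lmax + lmax_m1) / 2 < tau ->
        vnorm rin / vnorm r1 <=
          2 * (1 - 2 / (1 + Num.sqrt ((tau - lmin + delta)
                                      / (tau - lmax_m1 - delta)))) ^+ j,
      tau < (lmin + lmin_m1) / 2 ->
        vnorm rin / vnorm r1 <=
          2 * (1 - 2 / (1 + Num.sqrt ((lmax - tau + delta)
                                      / (lmin_m1 - tau - delta)))) ^+ j
    & (lmin + lmin_m1) / 2 < tau < (lmax + lmax_m1) / 2 ->
        vnorm rin / vnorm r1 <=
          2 * (1 - 2 / (1 + (`|lambda`_n.-1 - tau| + delta)
                            / (`|lambda`_m - tau| - delta))) ^+ (j./2)].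
Proof.
move=> Xtm xt1 r1 B rin delta lmax lmax_m1 lmin lmin_m1 r1_neq0 t_min delta_lt.
pose K := Xtm *m Xtm^t*.
have SS : (Xt *m S)^t* *m (Xt *m S) = 1%:M.
  by rewrite adjM mulmxA -(mulmxA _ _ Xt) Xt_orthonormal mulmx1.
have XtmXtm : Xtm^t* *m Xtm = 1%:M := first_cols_isom le_mk SS.
have Kadj : K^t* = K := isom_projector_adj Xtm.
have KK : K *m K = K := isom_projector_idem XtmXtm.
have XtmE : Xtm = Xt *m first_cols le_mk S := first_colsM le_mk Xt S.
have xt1E : xt1 = Xt *m col (Ordinal (leq_trans m_gt0 le_mk)) S.
  by rewrite /xt1 !colE mulmxA.
(* Galerkin condition: the Ritz residual is orthogonal to the whole search space, hence K r1 = 0. *)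
have Xtr : Xt^t* *m r1 = 0.
  rewrite /r1 mulmxBr -scalemxAr xt1E [Xt^t* *m (Xt *m _)]mulmxA Xt_orthonormal.
  by rewrite mul1mx !mulmxA ritz (tnth_nth 0) subrr.
have Kr : K *m r1 = 0.
  have Xtmr : Xtm^t* *m r1 = 0 by rewrite XtmE adjM -mulmxA Xtr mulmx0.
  by rewrite /K -mulmxA Xtmr mulmx0.
have XX : X^t* *m X = 1%:M by apply: mulmx1C; apply/unitarymxP.
have XX' := mulmx1C XX.
pose mu : 'rV[R]_n := \row_i (tnth lambda i - tau).
have shiftE : A - (tau%:C)%:M = X *m diagC mu *m X^t*.
  have -> : diagC mu = diagC (\row_i tnth lambda i) - (tau%:C)%:M.
    apply/matrixP => i l; rewrite !mxE; case: (i == l) => /=.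
      by rewrite !mulr1n rmorphB.
    by rewrite !mulr0n subrr.
  by rewrite mulmxBr mulmxBl -A_eigen mul_mx_scalar -scalemxAl XX' scalemx1.
have shift_adj : (A - (tau%:C)%:M)^t* = A - (tau%:C)%:M.
  by rewrite shiftE !adjM trmxCK adj_diagC mulmxA.
have Bh : B \is hermsymmx.
  apply/is_hermitianmxP; rewrite expr0 scale1r !adjM shift_adj.
  by rewrite -/K adj1B Kadj mulmxA.
(* Change to the eigenbasis of A: Xt_m becomes U, X_m becomes V, and the angles are unchanged
   because X is unitary. *)
pose U := X^t* *m Xtm.
have UU : U^t* *m U = 1%:M.
  by rewrite adjM trmxCK mulmxA -(mulmxA _ X) XX' mulmx1.
pose V := first_cols (ltnW lt_mn) (1%:M : 'M[R[i]]_n).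
have VV : V^t* *m V = 1%:M.
  by apply: first_cols_isom; rewrite mulmx1 trmx1 map_mx1.
have UV : canonical_angles U V phi.
  rewrite /canonical_angles /U adjM trmxCK -mulmxA -[X *m V]first_colsM mulmx1.
  exact: phi_angles.
set s := opnorm _ in delta delta_lt *.
have s0 : 0 <= s := opnorm_ge0 (opbound_diag_sin phi).
have UUE : U *m U^t* = X^t* *m K *m X by rewrite adjM trmxCK !mulmxA.
have tail : opbound (tail_proj R n m *m (X^t* *m K *m X)) s.
  have := canonical_angles_bound UU VV UV.
  by rewrite UUE (first_cols1_projector R (ltnW lt_mn)).
(* The angles are symmetric in the two ranges; swap them and take the adjoint. *)
have head : opbound (head_proj R n m *m (1%:M - X^t* *m K *m X)) s.
  have := opbound_adj s0 (canonical_angles_bound VV UU (canonical_angles_sym UV)).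
  by rewrite adjM isom_projector_adj adj1B isom_projector_adj UUE
    (first_cols1_projector R (ltnW lt_mn)).
have Fadj : (X^t* *m K *m X)^t* = X^t* *m K *m X.
  by rewrite -UUE isom_projector_adj.
have FF : (X^t* *m K *m X) *m (X^t* *m K *m X) = X^t* *m K *m X.
  by rewrite -UUE isom_projector_idem.
have sz := size_tuple lambda.
have n_gt0 : (0 < n)%N := leq_ltn_trans (leq0n m) lt_mn.
have muE (i : 'I_n) : mu 0 i = lambda`_i - tau by rewrite mxE (tnth_nth 0).
set M : R := `|lambda`_n.-1 - tau| in delta delta_lt *.
have dist_M x : x \in val lambda -> `|x - tau| <= M.
  move=> /(nthP 0)[l l_n <-]; apply: dist_target_le => //.
  by rewrite sz in l_n *; rewrite prednK// leqnn andbT -ltnS prednK.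
have mu_le (i : 'I_n) : `|mu 0 i| <= M.
  by rewrite muE dist_M// mem_nth// sz.
set g : R := `|lambda`_m - tau| in delta_lt *.
have g_mu (i : 'I_n) : (m <= i)%N -> g <= `|mu 0 i|.
  by move=> mi; rewrite muE dist_target_le// sz mi ltn_ord.
have gM : g <= M by rewrite dist_M// mem_nth// sz.
have Ms0 : 0 <= M * s ^+ 2 by apply: mulr_ge0 (normr_ge0 _) (sqr_ge0 _).
have deltaE : delta = 3 * M * s ^+ 2 by [].
have delta0 : 0 <= delta by rewrite deltaE; lra.
have r1_gt0 : 0 < vnorm r1 by rewrite vnorm_gt0.
(* Common core of (i) and (ii), with eps = -1 and eps = 1. The compressed spectrum lies in
   [a - 2 M s^2, b], inside [a - delta, b + delta]. *)
have definite (eps a b : R) : `|eps| = 1 -> 0 <= a <= M -> delta < a ->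
    (forall i : 'I_n, (m <= i)%N -> a <= eps * mu 0 i) ->
    (forall i : 'I_n, eps * mu 0 i <= b) ->
    vnorm rin / vnorm r1 <=
      2 * (1 - 2 / (1 + Num.sqrt ((b + delta) / (a - delta)))) ^+ j.
  move=> eps1 aM delta_a a_mu mu_b; rewrite ler_pdivrMr//.
  have ab := le_trans (a_mu (Ordinal lt_mn) (leqnn m)) (mu_b _).
  apply: (minres_definite_bound (eps := eps)) => //; [lra|lra|].
  move=> beta v v0 Bv vr.
  have [w [w0 Fw wE]] := correction_eigenvector XX shiftE Kadj KK Kr Bv vr.
  have := compressed_ge_definite mu_le s0 Fadj head w0 Fw wE eps1 aM a_mu.
  have := compressed_le Fadj w0 Fw wE mu_b.
  move=> h1 h2; apply/andP; split; lra.
have lambda_in (i : 'I_n) : lambda`_i \in val lambda by rewrite mem_nth// sz.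
split.
- move=> /(target_above_largest _ lambda_sorted); rewrite sz => /(_ lt_mn).
  rewrite -/lmax_m1 -/g => -[L_tau g_le le_L].
  have := @definite (-1) (tau - lmax_m1) (tau - lmin).
  apply; rewrite ?normrN1//; [|lra| |].
  + have : lmax_m1 \in val lambda by rewrite ith_largest_mem// sz.
    by move=> /dist_M; rewrite ler_norml; lra.
  + move=> i mi; rewrite muE mulN1r opprB lerD2l lerN2 le_L//.
    by rewrite mi ltn_ord.
  + by move=> i; rewrite muE mulN1r opprB lerD2l lerN2 ith_smallest1_le.
(* Reflecting the eigenvalues and the target turns the ordering question of (ii) into that of
   (i). *)
- pose opp_lambda := [seq - x | x <- lambda].
  have sz' : size opp_lambda = n by rewrite size_map.
  have opp_sorted : sorted (fun a b => `|a - - tau| <= `|b - - tau|) opp_lambda.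
    rewrite sorted_map; apply: sub_sorted lambda_sorted => x y /=.
    by rewrite -!opprD !normrN.
  have lminE : lmin = - ith_largest opp_lambda 1 by rewrite -ith_smallest_opp ?sz.
  have lmin_m1E : lmin_m1 = - ith_largest opp_lambda m.+1.
    by rewrite -ith_smallest_opp ?sz.
  move=> mid; have := @target_above_largest _ opp_lambda (- tau) m.
  rewrite sz' => /(_ lt_mn opp_sorted) [|L_tau g_le le_L]; first by lra.
  rewrite (nth_map 0) ?sz// -opprD normrN -/g in g_le.
  apply: (definite 1); rewrite ?normr1//; [|lra| |].
  + have : lmin_m1 \in val lambda.
      rewrite lmin_m1E; have := @ith_largest_mem _ opp_lambda m.+1.
      by rewrite sz' => /(_ lt_mn)/mapP[x x_in ->]; rewrite opprK.
    by move=> /dist_M; rewrite ler_norml; lra.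
  + move=> i mi; rewrite muE mul1r lerD2r lmin_m1E lerNl -(nth_map _ 0) ?sz//.
    by rewrite le_L// mi ltn_ord.
  + by move=> i; rewrite muE mul1r lerD2r ith_largest1_ge.
- move=> _; rewrite ler_pdivrMr//.
  apply: (minres_indefinite_bound Bh t_min); [lra|lra|].
  move=> beta v v0 Bv vr.
  have [w [w0 Fw wE]] := correction_eigenvector XX shiftE Kadj KK Kr Bv vr.
  (* From 3 M s^2 = delta < g <= M; a larger s would give delta >= 9 M / 4. *)
  have s34 : s ^+ 2 <= 3 / 4.
    rewrite leNgt; apply/negP => s34; have : M * (3 / 4) <= M * s ^+ 2.
      exact: ler_wpM2l (normr_ge0 _) _ _ (ltW s34).
    by move: delta_lt; rewrite deltaE; lra.
  have := compressed_ge_indefinite mu_le s0 Fadj FF head tail w0 Fw wE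
    (normr_ge0 _) g_mu s34.
  have mu_le1 (i : 'I_n) : 1 * mu 0 i <= M.
    by rewrite mul1r (le_trans (ler_norm _)).
  have mu_leN (i : 'I_n) : -1 * mu 0 i <= M.
    by rewrite mulN1r (le_trans (ler_norm _))// normrN.
  have := compressed_le Fadj w0 Fw wE mu_le1.
  have := compressed_le Fadj w0 Fw wE mu_leN.
  rewrite mul1r mulN1r -/g -deltaE => bN b1 h.
  by rewrite h ler_norml; lra.
Qed.
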